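(* Let $p\ge 3$ be an odd integer and let $P=A_0A_1\cdots A_{p-1}$ be a $p$-gon of density $q$ inscribed in and circumscribed about a pair of homothetic ellipses with common center $O$ (inscribed in one and circumscribed about the other), whose inellipse (the one about which $P$ is circumscribed) has semi-axes of lengths $\alpha$ and $\beta$. Then $$\sum_{k=0}^{p-1}|OA_k|^2=\frac{p}{2}\,(\alpha^2+\beta^2)\sec^2\!\left(\frac{q\pi}{p}\right).$$
   Context: All objects lie in the Euclidean plane. A $p$-gon $A_0A_1\cdots A_{p-1}$ is a cyclically ordered sequence of $p$ distinct points (vertices), with sides $\overline{A_kA_{k+1}}$ (indices modulo $p$); it may be self-crossing. It is inscribed in an ellipse if all its vertices lie on the ellipse, and circumscribed about an ellipse if every line $A_kA_{k+1}$ is tangent to the ellipse. Two ellipses with common center $O$ are homothetic if one is the image of the other under a homothety centered at $O$; circles are allowed as ellipses. Density: for coprime positive integers $p,q$ with $1\le q\le\lfloor p/2\rfloor$, the regular polygon $\{p/q\}$ has vertices obtained by successive rotations of a vertex about the center through the angle $2q\pi/p$. A $p$-gon has density $q$ if its vertices are connected according to the same cyclic ordering as $\{p/q\}$: that is, if $V_0,V_1,\dots,V_{p-1}$ are its vertices listed in cyclic order around the outer ellipse (in a suitable one of the two directions, starting at $V_0=A_0$), then $A_k=V_{qk \bmod p}$ for all $k$. *)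

(* Defs.v *)
From HB Require Import structures.
From mathcomp Require Import all_boot all_order all_algebra.
From mathcomp Require Import all_classical all_reals all_analysis.

Set Implicit Arguments.
Unset Strict Implicit.
Unset Printing Implicit Defensive.

Import Order.TTheory GRing.Theory Num.Theory.
Import numFieldNormedType.Exports.

Local Open Scope classical_set_scope.
Local Open Scope ring_scope.

Section EllipsesAndPolygons.
Variable R : realType.
Implicit Types (O X Y A B u v : 'rV[R]_2) (E L : set 'rV[R]_2) (a b r t : R).

Definition sec t : R := (cos t)^-1.

(* The library norm on 'rV[R]_2 is the sup norm, hence an explicit Euclidean
   structure. *)
Definition dotp u v : R := \sum_(i < 2) u 0 i * v 0 i.

Definition eucl_dist X Y : R := Num.sqrt (dotp (X - Y) (X - Y)).

(* Either orientation of the frame (u, v) is allowed. *)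
Definition orthonormal_frame u v : Prop :=
  [/\ dotp u u = 1, dotp v v = 1 & dotp u v = 0].

(* E is the ellipse with centre O and semi-axes a along u and b along v; a and b
   come in no particular order, and a = b gives a circle. *)
Definition ellipse_in_frame E O u v a b : Prop :=
  [/\ orthonormal_frame u v, 0 < a, 0 < b &
      E = [set X | (dotp (X - O) u / a) ^+ 2 + (dotp (X - O) v / b) ^+ 2 = 1]].

Definition is_ellipse E O a b : Prop :=
  exists u v, ellipse_in_frame E O u v a b.

Definition ellipse_point O u v a b t : 'rV[R]_2 :=
  O + (a * cos t) *: u + (b * sin t) *: v.

Definition homothety O r X : 'rV[R]_2 := O + r *: (X - O).

(* E and E' are meant to be ellipses with centre O. *)
Definition homothetic O E E' : Prop :=
  exists2 r, r != 0 & E' = [set homothety O r X | X in E].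

Definition line A B : set 'rV[R]_2 := [set A + t *: (B - A) | t in [set: R]].

(* A line is tangent to an ellipse when they have exactly one common point. *)
Definition tangent L E : Prop := exists T, L `&` E = [set T].

(* The polygon P_0 ... P_(p-1); ordS is the successor modulo p. *)
Definition is_polygon (p : nat) (P : 'I_p -> 'rV[R]_2) : Prop := injective P.

Definition inscribed (p : nat) (P : 'I_p -> 'rV[R]_2) E : Prop :=
  forall k, E (P k).

Definition circumscribed (p : nat) (P : 'I_p -> 'rV[R]_2) E : Prop :=
  forall k, tangent (line (P k) (P (ordS k))) E.

(* V 0, ..., V p.-1 are met in this order during a single turn around the
   ellipse E, in one of the two directions: replacing v by - v in the frame
   reverses the direction. Values V j with p <= j are irrelevant. *)
Definition cyclically_listed E O (p : nat) (V : nat -> 'rV[R]_2) : Prop :=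
  exists u v a b (theta : nat -> R),
    [/\ ellipse_in_frame E O u v a b,
        forall i j, (i < j < p)%N -> theta i < theta j,
        forall i, (i < p)%N -> theta i < theta 0%N + 2 * pi &
        forall i, (i < p)%N -> V i = ellipse_point O u v a b (theta i)].

(* Meaningful for P inscribed in E, an ellipse with centre O; the case k = 0 gives
   P_0 = V 0. *)
Definition has_density E O (p : nat) (P : 'I_p -> 'rV[R]_2) (q : nat) : Prop :=
  [/\ coprime p q, (1 <= q <= p %/ 2)%N &
      exists2 V, cyclically_listed E O p V &
                 forall k : 'I_p, P k = V ((q * k) %% p)%N].

End EllipsesAndPolygons.

(* Main.v *)
Require Import Defs.
From HB Require Import structures.
From mathcomp Require Import all_boot all_order all_algebra.
From mathcomp Require Import ring lra zify.
From mathcomp Require Import all_classical all_reals all_analysis.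

Set Implicit Arguments.
Unset Strict Implicit.
Unset Printing Implicit Defensive.

Import Order.TTheory GRing.Theory Num.Theory.
Import numFieldNormedType.Exports.

Local Open Scope classical_set_scope.
Local Open Scope ring_scope.

(** Let the outer ellipse be O + (a cos t) u + (b sin t) v. In the affine
    coordinates that divide by a along u and by b along v it becomes the unit
    circle, and the inner ellipse a concentric circle of some radius m. A chord
    of the unit circle that touches the inner circle does so at its midpoint, so
    the angles s, t of its ends satisfy 1 + cos (t - s) = 2 m^2
    ([tangent_chord_cos]): all sides of the polygon subtend the same angle up to
    sign.

    The density fixes the signs. Unrolling the angles of the cyclically listed
    vertices to an increasing sequence on the real line, the vertices
    A_0, A_1, ... get angles T 0 < T 1 < ... with steps between 0 and 2 pi, and
    T p = T 0 + 2 pi q. The steps all have the same cosine, hence two successive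
    steps are equal or add up to 2 pi; the second would give A_(k+2) = A_k. So T
    is an arithmetic progression of step D = 2 pi q / p ([equal_chords_arith]),
    and m = cos (D / 2).

    Since p is odd and 2 q < p, sin D is nonzero, so that the cosines of 2 (T k)
    sum to zero ([sum_cos_arith]) and the squared distances to O sum to
    p / 2 (a^2 + b^2). Finally (m a)^2 + (m b)^2 = alpha^2 + beta^2, because the
    semi-axes can be read off the largest and the smallest distance from O to
    the inner ellipse ([ellipse_axes_sqr_sum]). *)

(** * Orthonormal frames *)

Lemma dotpDl (R : realType) (u v w : 'rV[R]_2) :
  dotp (u + v) w = dotp u w + dotp v w.
Proof. by rewrite /dotp !big_ord_recl !big_ord0 !mxE; ring. Qed.

Lemma dotpZl (R : realType) (c : R) (u w : 'rV[R]_2) :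
  dotp (c *: u) w = c * dotp u w.
Proof. by rewrite /dotp !big_ord_recl !big_ord0 !mxE; ring. Qed.

Lemma dotpC (R : realType) (u v : 'rV[R]_2) : dotp u v = dotp v u.
Proof. by rewrite /dotp; apply: eq_bigr => i _; rewrite mulrC. Qed.

Lemma dotp_ge0 (R : realType) (u : 'rV[R]_2) : 0 <= dotp u u.
Proof. by apply: sumr_ge0 => i _; rewrite -expr2 sqr_ge0. Qed.

Lemma dotp_frame (R : realType) (u v : 'rV[R]_2) (x y : R) :
  orthonormal_frame u v ->
  [/\ dotp (x *: u + y *: v) u = x, dotp (x *: u + y *: v) v = y
    & dotp (x *: u + y *: v) (x *: u + y *: v) = x ^+ 2 + y ^+ 2].
Proof.
move=> [uu vv uv].
have hu : dotp (x *: u + y *: v) u = x.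
  by rewrite dotpDl !dotpZl (dotpC v) uu uv; ring.
have hv : dotp (x *: u + y *: v) v = y.
  by rewrite dotpDl !dotpZl uv vv; ring.
split=> //.
by rewrite [LHS]dotpDl !dotpZl ![dotp _ (_ + _)]dotpC hu hv; ring.
Qed.

(** The second vector of the frame is the first one turned by a right angle, in
    the direction given by the determinant e = 1 or -1 of the frame; Lagrange's
    identity then concludes. *)
Lemma frame_parseval (R : realType) (u v w : 'rV[R]_2) :
  orthonormal_frame u v -> dotp w w = dotp w u ^+ 2 + dotp w v ^+ 2.
Proof.
rewrite /orthonormal_frame /dotp !big_ord_recl !big_ord0 => -[].
set u0 := u _ _; set u1 := u _ _; set v0 := v _ _; set v1 := v _ _.
set w0 := w _ _; set w1 := w _ _ => uu vv uv.
set e := u0 * v1 - u1 * v0.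
(* The summands 0 below match the unfolded sums in the hypotheses. *)
have v0E : v0 = - e * u1.
  apply/eqP; rewrite -subr_eq0; apply/eqP; transitivity
    (u0 * (u0 * v0 + (u1 * v1 + 0)) - v0 * (u0 * u0 + (u1 * u1 + 0) - 1)).
    by rewrite /e; ring.
  by rewrite uu uv; ring.
have v1E : v1 = e * u0.
  apply/eqP; rewrite -subr_eq0; apply/eqP; transitivity
    (u1 * (u0 * v0 + (u1 * v1 + 0)) - v1 * (u0 * u0 + (u1 * u1 + 0) - 1)).
    by rewrite /e; ring.
  by rewrite uu uv; ring.
have e2 : e ^+ 2 = 1.
  transitivity ((u0 * u0 + (u1 * u1 + 0)) * (v0 * v0 + (v1 * v1 + 0))
    - (u0 * v0 + (u1 * v1 + 0)) ^+ 2); first by rewrite /e; ring.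
  by rewrite uu vv uv; ring.
rewrite {}v0E {}v1E; transitivity ((w0 ^+ 2 + w1 ^+ 2) * 1); first by ring.
transitivity ((w0 * u0 + w1 * u1) ^+ 2 + e ^+ 2 * (w1 * u0 - w0 * u1) ^+ 2).
  by rewrite e2 mul1r -uu; ring.
by ring.
Qed.

(** * Semi-axes of an ellipse *)

(** The squared distance to the centre is a convex combination of the squares of
    the semi-axes: the weights are the two terms of the equation. *)
Lemma ellipse_sqr_bounds (R : realType) (E : set 'rV[R]_2) O u v a b X :
  ellipse_in_frame E O u v a b -> E X ->
  Num.min (a ^+ 2) (b ^+ 2) <= dotp (X - O) (X - O)
    <= Num.max (a ^+ 2) (b ^+ 2).
Proof.
move=> [fr a0 b0 ->] /=; rewrite (frame_parseval (X - O) fr).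
set x := dotp _ u; set y := dotp _ v => xy1.
have -> : x ^+ 2 = (x / a) ^+ 2 * a ^+ 2 by field; rewrite gt_eqF.
have -> : y ^+ 2 = (y / b) ^+ 2 * b ^+ 2 by field; rewrite gt_eqF.
move: xy1 (sqr_ge0 (x / a)) (sqr_ge0 (y / b)).
move: ((x / a) ^+ 2) ((y / b) ^+ 2) (a ^+ 2) (b ^+ 2) => s t A B st s0 t0.
have -> : t = 1 - s by lra.
by rewrite ge_min le_max; case: (leP A B) => AB; apply/andP; split;
  apply/orP; [left|right|right|left]; nra.
Qed.

Lemma ellipse_axis_end (R : realType) (E : set 'rV[R]_2) O u v a b :
  ellipse_in_frame E O u v a b ->
  (exists2 X, E X & dotp (X - O) (X - O) = a ^+ 2) /\
  (exists2 X, E X & dotp (X - O) (X - O) = b ^+ 2).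
Proof.
move=> [fr a0 b0 ->]; split.
- have [hu hv hw] := dotp_frame a 0 fr.
  exists (O + (a *: u + 0 *: v));
    rewrite /= (addrC O) addrK ?hu ?hv ?hw; last by ring.
  by field; rewrite !gt_eqF.
- have [hu hv hw] := dotp_frame 0 b fr.
  exists (O + (0 *: u + b *: v));
    rewrite /= (addrC O) addrK ?hu ?hv ?hw; last by ring.
  by field; rewrite !gt_eqF.
Qed.

Lemma ellipse_axes_bounds (R : realType) (E : set 'rV[R]_2) O u v a b u' v' a' b' :
  ellipse_in_frame E O u v a b -> ellipse_in_frame E O u' v' a' b' ->
  Num.min (a ^+ 2) (b ^+ 2) <= Num.min (a' ^+ 2) (b' ^+ 2) /\
  Num.max (a' ^+ 2) (b' ^+ 2) <= Num.max (a ^+ 2) (b ^+ 2).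
Proof.
move=> h h'.
have [[X /(ellipse_sqr_bounds h) + <-] [Y /(ellipse_sqr_bounds h) + <-]] :=
  ellipse_axis_end h'.
by move=> /andP[? ?] /andP[? ?]; rewrite le_min ge_max; split; apply/andP.
Qed.

(** A frame of an ellipse need not be unique (a circle has infinitely many, and
    the axes can be swapped), but the extreme distances to the centre are
    intrinsic. *)
Lemma ellipse_axes_sqr_sum (R : realType) (E : set 'rV[R]_2) O u v a b u' v' a' b' :
  ellipse_in_frame E O u v a b -> ellipse_in_frame E O u' v' a' b' ->
  a ^+ 2 + b ^+ 2 = a' ^+ 2 + b' ^+ 2.
Proof.
move=> h h'.
have [min1 max1] := ellipse_axes_bounds h h'.
have [min2 max2] := ellipse_axes_bounds h' h.
rewrite -addr_max_min -[RHS]addr_max_min; congr (_ + _); apply: le_anti.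
  by rewrite max1 max2.
by rewrite min1 min2.
Qed.

(** * Chords of an ellipse that touch a homothetic one *)

Lemma homothetic_ellipse (R : realType) (E F : set 'rV[R]_2) O u v a b (r : R) :
  r != 0 -> F = [set homothety O r X | X in E] ->
  ellipse_in_frame F O u v a b ->
  ellipse_in_frame E O u v (a / `|r|) (b / `|r|).
Proof.
move=> r0 FE [fr a0 b0 FE'].
have nr0 : 0 < `|r| by rewrite normr_gt0.
split=> //; rewrite ?divr_gt0//.
have coordE (x c : R) : 0 < c -> (x / (c / `|r|)) ^+ 2 = (r * x / c) ^+ 2.
  move=> c0; transitivity ((x / c) ^+ 2 * `|r| ^+ 2).
    by field; rewrite !gt_eqF.
  by rewrite real_normK ?num_real//; field; rewrite gt_eqF.
have FhE X : F (homothety O r X) =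
    ((dotp (X - O) u / (a / `|r|)) ^+ 2 + (dotp (X - O) v / (b / `|r|)) ^+ 2 = 1).
  by rewrite FE' /= /homothety (addrC O) addrK !dotpZl !coordE.
apply/seteqP; split=> X /=; rewrite -FhE FE /=; first by exists X.
move=> [Y EY]; rewrite /homothety => /addrI /(scalerI r0) /addIr.
by move=> <-.
Qed.

(** The chord P Q meets E symmetrically with respect to its midpoint, as E and F
    are level sets of the same quadratic form; a unique common point has to be
    the midpoint. *)
Lemma tangent_chord_midpoint (R : realType) (E F : set 'rV[R]_2) O u v a b (m : R) P Q :
  0 < m -> ellipse_in_frame F O u v a b ->
  ellipse_in_frame E O u v (a * m) (b * m) ->
  F P -> F Q -> P != Q -> tangent (line P Q) E -> E (P + 2^-1 *: (Q - P)).
Proof.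
move=> m0 [fr a0 b0 ->] [_ _ _ EE] /= FP FQ PQ [T LT].
have inE X : E X = ((dotp (X - O) u / a) ^+ 2 + (dotp (X - O) v / b) ^+ 2 = m ^+ 2).
  rewrite EE /=; apply/propext; split=> h.
    by rewrite -[RHS]mulr1 -h; field; rewrite !gt_eqF.
  transitivity (((dotp (X - O) u / a) ^+ 2 + (dotp (X - O) v / b) ^+ 2) / m ^+ 2).
    by field; rewrite !gt_eqF.
  by rewrite h divff// expf_neq0// gt_eqF.
have coordE t w : dotp (P + t *: (Q - P) - O) w =
    dotp (P - O) w + t * (dotp (Q - O) w - dotp (P - O) w).
  have -> : P + t *: (Q - P) - O = (P - O) + t *: ((Q - O) + (-1) *: (P - O)).
    by rewrite scaleN1r opprB addrA subrK addrAC.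
  by rewrite [LHS]dotpDl dotpZl [X in _ + t * X = _]dotpDl dotpZl mulN1r.
have sym t : E (P + t *: (Q - P)) -> E (P + (1 - t) *: (Q - P)).
  rewrite !inE => <-; rewrite !coordE.
  move: FP FQ; move: (dotp (P - O) u) (dotp (P - O) v) (dotp (Q - O) u)
    (dotp (Q - O) v) => x y x' y' FP FQ.
  apply/eqP; rewrite -subr_eq0; apply/eqP.
  transitivity ((1 - t *+ 2) * (((x' / a) ^+ 2 + (y' / b) ^+ 2) -
     ((x / a) ^+ 2 + (y / b) ^+ 2))); last by rewrite FP FQ subrr mulr0.
  by ring.
have : (line P Q `&` E) T by rewrite LT.
move=> [[t _ tT] ET].
have : (line P Q `&` E) (P + (1 - t) *: (Q - P)).
  by split; [exists (1 - t) | apply: sym; rewrite tT].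
rewrite LT /= -tT => /addrI tE.
have : (1 - t - t) *: (Q - P) = 0 by rewrite scalerBl tE subrr.
move=> /eqP; rewrite scaler_eq0 !subr_eq0 [Q == P]eq_sym (negPf PQ) orbF => /eqP t12.
have <- : t = 2^-1 by lra.
by rewrite tT.
Qed.

Lemma ellipse_pointB (R : realType) O u v (a b t : R) :
  ellipse_point O u v a b t - O = (a * cos t) *: u + (b * sin t) *: v.
Proof. by rewrite /ellipse_point -addrA addrC addrA addrNK addrC. Qed.

Lemma ellipse_point_in (R : realType) (E : set 'rV[R]_2) O u v a b (t : R) :
  ellipse_in_frame E O u v a b -> E (ellipse_point O u v a b t).
Proof.
move=> [fr a0 b0 ->]; rewrite /= ellipse_pointB.
have [-> -> _] := dotp_frame (a * cos t) (b * sin t) fr.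
by rewrite -[RHS](cos2Dsin2 t); field; rewrite !gt_eqF.
Qed.

Lemma ellipse_point_dist (R : realType) O u v (a b t : R) :
  orthonormal_frame u v ->
  eucl_dist O (ellipse_point O u v a b t) ^+ 2 =
  (a * cos t) ^+ 2 + (b * sin t) ^+ 2.
Proof.
move=> fr; rewrite /eucl_dist sqr_sqrtr ?dotp_ge0//.
rewrite -opprB ellipse_pointB.
have [_ _ <-] := dotp_frame (a * cos t) (b * sin t) fr.
by rewrite -scaleN1r dotpZl dotpC dotpZl !mulN1r opprK.
Qed.

Lemma ellipse_pointD2pi (R : realType) O u v (a b t : R) n :
  ellipse_point O u v a b (t + (pi *+ 2) *+ n) = ellipse_point O u v a b t.
Proof.
by rewrite /ellipse_point (periodicn (@cosD2pi R)) (periodicn (@sinD2pi R)).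
Qed.

(** In the coordinates where F is the unit circle, the midpoint of the chord is
    at squared distance (1 + cos (t - s)) / 2 from the centre. *)
Lemma tangent_chord_cos (R : realType) (E F : set 'rV[R]_2) O u v a b (m s t : R) :
  let P := ellipse_point O u v a b in
  0 < m -> ellipse_in_frame F O u v a b ->
  ellipse_in_frame E O u v (a * m) (b * m) ->
  P s != P t -> tangent (line (P s) (P t)) E ->
  1 + cos (t - s) = 2 * m ^+ 2.
Proof.
move=> P m0 FF EE Pst tan.
have := tangent_chord_midpoint m0 FF EE (ellipse_point_in s FF)
  (ellipse_point_in t FF) Pst tan.
have [fr a0 b0 _] := FF; have [_ _ _ ->] := EE => /=.
have -> : P s + 2^-1 *: (P t - P s) - O =
    (a * ((cos s + cos t) / 2)) *: u + (b * ((sin s + sin t) / 2)) *: v.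
  by apply/matrixP => i j; rewrite /P /ellipse_point !mxE; field.
have [-> -> _] := dotp_frame (a * ((cos s + cos t) / 2)) (b * ((sin s + sin t) / 2)) fr.
move=> h; rewrite cosB; move: (cos2Dsin2 s) (cos2Dsin2 t) => cs ct.
transitivity (2 * m ^+ 2 * ((a * ((cos s + cos t) / 2) / (a * m)) ^+ 2 +
  (b * ((sin s + sin t) / 2) / (b * m)) ^+ 2)); last by rewrite h mulr1.
transitivity (((cos s ^+ 2 + sin s ^+ 2) + (cos t ^+ 2 + sin t ^+ 2)) / 2
  + cos t * cos s + sin t * sin s); first by rewrite cs ct; field.
by field; rewrite !gt_eqF.
Qed.

(** * Angles of successive vertices *)

Lemma cos_eq_turn (R : realType) (x y : R) :
  0 < x < 2 * pi -> 0 < y < 2 * pi -> cos x = cos y -> x = y \/ x + y = 2 * pi.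
Proof.
have reflect (z : R) : cos (2 * pi - z) = cos z.
  by rewrite -[LHS]cosN opprB -(cosD2pi (z - _)) mulr2n; congr cos; ring.
move=> /andP[x0 x2] /andP[y0 y2] cxy.
have inj (z z' : R) : 0 <= z <= pi -> 0 <= z' <= pi -> cos z = cos z' -> z = z'.
  by move=> hz hz'; apply: cos_inj; rewrite in_itv.
have [xp|xp] := leP x pi; have [yp|yp] := leP y pi.
- by left; apply: inj => //; apply/andP; split; lra.
- right; suff -> : x = 2 * pi - y by ring.
  by apply: inj; rewrite ?reflect//; apply/andP; split; lra.
- right; suff -> : y = 2 * pi - x by ring.
  by apply: inj; rewrite ?reflect//; apply/andP; split; lra.
- left; suff : 2 * pi - x = 2 * pi - y by lra.
  by apply: inj; rewrite ?reflect//; apply/andP; split; lra.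
Qed.

(** If two successive steps differed, they would add up to a full turn, which
    leads back to the point on the circle where the first step began. *)
Lemma equal_chords_arith (R : realType) (T : nat -> R) (c : R) :
  (forall k, 0 < T k.+1 - T k < 2 * pi) ->
  (forall k, cos (T k.+1 - T k) = c) ->
  (forall k, T k.+2 <> T k + 2 * pi) ->
  forall k, T k = T 0%N + (T 1%N - T 0%N) *+ k.
Proof.
move=> step cstep noback.
have const k : T k.+1 - T k = T 1%N - T 0%N.
  elim: k => // k <-.
  have [//|back] := cos_eq_turn (step k.+1) (step k) (etrans (cstep _) (esym (cstep k))).
  by case: (noback k); lra.
elim=> [|k IHk]; first by rewrite mulr0n addr0.
by rewrite mulrSr addrA -IHk -(const k); ring.
Qed.

(** * Summation over the vertices *)

(** Multiplied by sin D, each term is half the difference of the sines of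
    2 x + (2 k + 1) D and 2 x + (2 k - 1) D: the sum telescopes over a whole
    number of periods. *)
Lemma sum_cos_arith (R : realType) (p n : nat) (x D : R) :
  sin D != 0 -> D *+ p = pi *+ n ->
  \sum_(k < p) cos ((x + D *+ k) *+ 2) = 0.
Proof.
move=> sD pD; apply: (mulfI sD); rewrite mulr0 mulr_sumr.
pose f k : R := sin (x *+ 2 - D + (D *+ k) *+ 2) / 2.
have telE k : sin D * cos ((x + D *+ k) *+ 2) = f k.+1 - f k.
  have -> : f k.+1 = sin ((x + D *+ k) *+ 2 + D) / 2.
    by rewrite /f; congr (sin _ / 2); rewrite mulrS !mulr2n; ring.
  have -> : f k = sin ((x + D *+ k) *+ 2 - D) / 2.
    by rewrite /f; congr (sin _ / 2); rewrite !mulr2n; ring.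
  by rewrite sinD sinB; field.
under eq_bigr do rewrite telE.
rewrite -(big_mkord xpredT (fun k => f k.+1 - f k)).
rewrite telescope_sumr// /f pD mulr0n mul0rn addr0 mulrnAC.
by rewrite (periodicn (@sinD2pi R)) subrr.
Qed.

Lemma sum_dist_arith (R : realType) O u v (a b x D : R) (p n : nat) :
  orthonormal_frame u v -> sin D != 0 -> D *+ p = pi *+ n ->
  \sum_(k < p) eucl_dist O (ellipse_point O u v a b (x + D *+ k)) ^+ 2 =
  p%:R / 2 * (a ^+ 2 + b ^+ 2).
Proof.
move=> fr sD pD.
have distE k : eucl_dist O (ellipse_point O u v a b (x + D *+ k)) ^+ 2 =
    (a ^+ 2 + b ^+ 2) / 2 + (a ^+ 2 - b ^+ 2) / 2 * cos ((x + D *+ k) *+ 2).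
  by rewrite ellipse_point_dist// !exprMn sin2cos2 cos_mulr2n; field.
under eq_bigr do rewrite distE.
rewrite big_split /= sumr_const card_ord -mulr_sumr.
rewrite (sum_cos_arith _ sD pD) mulr0 addr0 -mulr_natl.
by ring.
Qed.

(** * Unrolling the angles of the vertices *)

(** The angles of p points in cyclic order, continued over all turns: an
    increasing sequence that gains 2 pi every p terms. *)
Definition unroll (R : realType) (p : nat) (theta : nat -> R) (n : nat) : R :=
  theta (n %% p)%N + (pi *+ 2) *+ (n %/ p).

Lemma unrollDp (R : realType) (p : nat) (theta : nat -> R) n k :
  (0 < p)%N ->
  unroll p theta (n + k * p) = unroll p theta n + (pi *+ 2) *+ k.
Proof.
by move=> p0; rewrite /unroll addnC modnMDl divnMDl// addnC mulrnDr addrA.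
Qed.

Lemma unroll_lt (R : realType) (p : nat) (theta : nat -> R) :
  (0 < p)%N ->
  (forall i j, (i < j < p)%N -> theta i < theta j) ->
  (forall i, (i < p)%N -> theta i < theta 0%N + 2 * pi) ->
  {homo unroll p theta : m n / (m < n)%N >-> m < n}.
Proof.
move=> p0 incr one_turn; apply: Order.NatMonotonyTheory.homo_ltn_lt => n.
rewrite {2}(divn_eq n p) -addnS addnC unrollDp// /unroll.
have := ltn_pmod n p0; rewrite leq_eqVlt => /predU1P[->|lt_p].
  rewrite modnn divnn p0 mulr1n ltrD2r mulr2n.
  by have := one_turn _ (ltn_pmod n p0); rewrite mulrDl mul1r.
by rewrite (modn_small lt_p) (divn_small lt_p) mulr0n addr0 ltrD2r incr// leqnn.
Qed.

Theorem corollary1 (R : realType) (p q : nat) (A : 'I_p -> 'rV[R]_2)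
    (O : 'rV[R]_2) (Ein Eout : set 'rV[R]_2) (alpha beta alpha' beta' : R)
    (hp : (3 <= p)%N) (podd : odd p)
    (hin : is_ellipse Ein O alpha beta)
    (hout : is_ellipse Eout O alpha' beta')
    (hhom : homothetic O Ein Eout)
    (hA : is_polygon A)
    (hins : inscribed A Eout)
    (hcirc : circumscribed A Ein)
    (hq : has_density Eout O A q) :
  \sum_(k < p) eucl_dist O (A k) ^+ 2 =
    p%:R / 2 * (alpha ^+ 2 + beta ^+ 2) * sec (q%:R * pi / p%:R) ^+ 2.
Proof.
have p0 : (0 < p)%N by lia.
have pR0 : 0 < p%:R :> R by rewrite ltr0n.
case: hq => _ /andP[q1 q2] [V [u [v [a [b [theta [Eout_uv incr one_turn VE]]]]]] AV].
have q2p : (q.*2 < p)%N.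
  rewrite leq_divRL// muln2 in q2; rewrite ltn_neqAle q2 andbT.
  by apply: contraTneq podd => <-; rewrite odd_double.
(* T k is an angle of the k-th vertex, for every k taken modulo p. *)
pose T k := unroll p theta (q * k).
have T_mono : {homo T : m n / (m < n)%N >-> m < n}.
  by move=> m n mn; apply: unroll_lt => //; rewrite ltn_mul2l q1 mn.
have T_turn k n : unroll p theta (k + n * p) = unroll p theta k + (pi *+ 2) *+ n.
  exact: unrollDp.
pose P t := ellipse_point O u v a b t.
have AT k (kp : (k < p)%N) : A (Ordinal kp) = P (T k).
  by rewrite AV /= VE ?ltn_pmod// /P /T /unroll ellipse_pointD2pi.
have T_period k n : P (T (k + n * p)%N) = P (T k).
  by rewrite /P /T mulnDr mulnA T_turn ellipse_pointD2pi.
have AT_mod k (kp : (k %% p < p)%N) : A (Ordinal kp) = P (T k).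
  by rewrite AT [in RHS](divn_eq k p) addnC T_period.
(* For j = 1 this makes each side a genuine chord; for j = 2 it excludes that
   the polygon turns back. *)
have neq_turn k j : (0 < j < p)%N -> P (T k) != P (T (k + j)%N).
  move=> /andP[j0 jp]; rewrite -(AT_mod k (ltn_pmod _ p0)) -(AT_mod (k + j)%N (ltn_pmod _ p0)).
  rewrite (inj_eq hA) -(inj_eq val_inj) /=.
  rewrite -[X in (X %% _)%N == _]addn0 eqn_modDl mod0n modn_small// eq_sym -lt0n//.
have [r r0 Eout_r] := hhom.
have rho0 : 0 < `|r|^-1 by rewrite invr_gt0 normr_gt0.
have Ein_uv := homothetic_ellipse r0 Eout_r Eout_uv.
have cosT k : cos (T k.+1 - T k) = 2 * `|r|^-1 ^+ 2 - 1.
  have neq : P (T k) != P (T k.+1) by rewrite -(addn1 k) neq_turn//; lia.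
  have := hcirc (Ordinal (ltn_pmod k p0)).
  have -> : ordS (Ordinal (ltn_pmod k p0)) = Ordinal (ltn_pmod k.+1 p0).
    by apply: val_inj; rewrite /= -addn1 modnDml addn1.
  rewrite !AT_mod => tan.
  by rewrite -(tangent_chord_cos rho0 Eout_uv Ein_uv neq tan); ring.
have stepT k : 0 < T k.+1 - T k < 2 * pi.
  rewrite subr_gt0 T_mono//= ltrBlDl.
  have -> : T k + 2 * pi = unroll p theta (q * k + 1 * p).
    by rewrite T_turn mulr1n mulr2n mulrDl mul1r.
  by apply: unroll_lt => //; rewrite mulnS addnC ltn_add2l mul1n; lia.
have nobackT k : T k.+2 <> T k + 2 * pi.
  move=> back; have /eqP := neq_turn k 2 hp; apply.
  rewrite addn2 back /P -(ellipse_pointD2pi _ _ _ _ _ (T k) 1).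
  by congr ellipse_point; rewrite mulr1n mulr2n mulrDl mul1r.
have TE := equal_chords_arith stepT cosT nobackT.
set D := T 1%N - T 0%N in TE.
(* After p steps of the polygon the angle has made q turns. *)
have pD : D *+ p = pi *+ q.*2.
  apply: (addrI (T 0%N)); rewrite -TE /T.
  by rewrite -[(q * p)%N]add0n T_turn muln0 -mul2n mulrnA.
have DE : D = 2 * (q%:R * pi / p%:R).
  apply: (mulIf (lt0r_neq0 pR0)); transitivity (pi *+ q.*2 : R).
    by rewrite -pD mulr_natr.
  rewrite -muln2 -[LHS]mulr_natr natrM.
  by field; rewrite gt_eqF.
have piR := pi_gt0 R.
have half0 : 0 < q%:R * pi / p%:R :> R by rewrite divr_gt0// mulr_gt0// ltr0n.
have half_lt : q%:R * pi / p%:R < pi / 2 :> R.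
  rewrite ltr_pdivrMr// mulrAC ltr_pdivlMr// mulrAC [ltRHS]mulrC ltr_pM2r//.
  by rewrite -natrM ltr_nat muln2.
have sD : sin D != 0.
  by rewrite gt_eqF// sin_gt0_pi// DE; apply/andP; split; lra.
have cos0 : cos (q%:R * pi / p%:R) != 0 :> R.
  by rewrite gt_eqF// cos_gt0_pihalf//; apply/andP; split; lra.
have r2E : `|r|^-1 ^+ 2 = cos (q%:R * pi / p%:R) ^+ 2 :> R.
  have := cosT 0%N; rewrite -/D DE mulr_natl cos_mulr2n -mulr_natl => h; lra.
have [u' [v' Ein_uv']] := hin.
rewrite -(ellipse_axes_sqr_sum Ein_uv Ein_uv') /sec.
have [fr _ _ _] := Eout_uv.
transitivity (\sum_(k < p) eucl_dist O (P (T 0%N + D *+ k)) ^+ 2).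
  by apply: eq_bigr => -[k kp] _; rewrite AT -TE.
rewrite (sum_dist_arith O a b (T 0%N) fr sD pD).
by rewrite !exprMn -mulrDl r2E; field; rewrite cos0.
Qed.
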